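(* Let $\alpha=(\alpha_n)_{n\in\mathbb{N}}$ be a sequence with $\alpha_n\uparrow\infty$ such that $\Lambda_0(\alpha)$ is nuclear. Then the range $(I-\mathsf{C})^m(\Lambda_0(\alpha))$ is a closed subspace of $\Lambda_0(\alpha)$ for each $m\in\mathbb{N}$.
   Context: Notation: $\mathbb{N}=\{1,2,3,\ldots\}$. The notation $\alpha_n\uparrow\infty$ means that $\alpha=(\alpha_n)_{n\in\mathbb{N}}\subseteq(1,\infty)$ satisfies $\alpha_n<\alpha_{n+1}$ for all $n\in\mathbb{N}$ and $\lim_{n\to\infty}\alpha_n=\infty$. For $k,n\in\mathbb{N}$ put $w_k(n):=e^{-\alpha_n/k}$. The power series space of finite type is $\Lambda_0(\alpha):=\{x\in\mathbb{C}^{\mathbb{N}}\colon \lim_{n\to\infty}w_k(n)|x_n|=0 \text{ for all } k\in\mathbb{N}\}$, a Fréchet space for the topology generated by the increasing sequence of norms $p_k(x):=\sup_{n\in\mathbb{N}}w_k(n)|x_n|$, $k\in\mathbb{N}$. The discrete Cesàro operator is $\mathsf{C}x:=\left(x_1,\frac{x_1+x_2}{2},\ldots,\frac{x_1+\cdots+x_n}{n},\ldots\right)$ for $x\in\mathbb{C}^{\mathbb{N}}$; it maps $\Lambda_0(\alpha)$ continuously into itself. $I$ denotes the identity operator. *)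

(* Defs.v *)
From HB Require Import structures.
From mathcomp Require Import all_boot all_order all_algebra complex.
From mathcomp Require Import all_classical all_reals all_analysis.
Import Order.TTheory GRing.Theory Num.Theory numFieldNormedType.Exports.

Set Implicit Arguments.
Unset Strict Implicit.
Unset Printing Implicit Defensive.

Local Open Scope classical_set_scope.
Local Open Scope ring_scope.
Local Open Scope complex_scope.

Section Nuclear.
Variable K : numFieldType.

(* As everywhere in the library, norms (hence seminorms) over [K] take their
   values in [K]; for [K = R[i]], [0 <= a] says that [a] is real and >= 0. *)
Definition is_seminorm (E : lmodType K) (p : E -> K) : Prop :=
  [/\ forall x, 0 <= p x,
      forall x y, p (x + y) <= p x + p y &
      forall (a : K) x, p (a *: x) = `|a| * p x].

Definition continuous_seminorm (E : tvsType K) (p : E -> K) : Prop :=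
  is_seminorm p /\ continuous p.

(* [T x = \sum_n l_n f_n(x) y_n] with [l] absolutely summable and [f_n], [y_n]
   in the closed unit balls of the dual of [X] and of [Y]. *)
Definition nuclear_map (X Y : normedModType K) (T : {linear X -> Y}) : Prop :=
  exists (l : nat -> K) (f : nat -> {linear X -> K^o}) (y : nat -> Y),
    [/\ cvgn [normed series l],
        forall n x, `|f n x| <= `|x|,
        forall n, `|y n| <= 1 &
        forall x, series (fun n => (l n * f n x) *: y n) @ \oo --> T x].

(* [B], with the canonical map [j], is the local Banach space of the seminorm
   [p]: the completion of [E / p^-1(0)] normed by [p]. *)
Definition local_banach (E : lmodType K) (p : E -> K)
    (B : completeNormedModType K) (j : {linear E -> B}) : Prop :=
  (forall x, `|j x| = p x) /\ dense (range j).

(* Every continuous seminorm [p] is dominated by a continuous seminorm [q] for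
   which the linking map [E_q -> E_p] between the local Banach spaces is
   nuclear. These spaces are unique up to isometry, hence the existentials. *)
Definition nuclear_space (E : tvsType K) : Prop :=
  forall p : E -> K, continuous_seminorm p ->
  exists q : E -> K,
    [/\ continuous_seminorm q,
        forall x, p x <= q x &
        exists (Bq Bp : completeNormedModType K)
               (jq : {linear E -> Bq}) (jp : {linear E -> Bp})
               (T : {linear Bq -> Bp}),
          [/\ local_banach q jq, local_banach p jp,
              forall x, T (jq x) = jp x & nuclear_map T]].

Definition closed_subspace (E : tvsType K) (A : set E) : Prop :=
  [/\ A 0,
      forall (a : K) (u v : E), A u -> A v -> A (a *: u + v) &
      closed A].

End Nuclear.

Section Normc.
Variable R : rcfType.
Implicit Types x y : R[i].
Local Notation normc := (@ComplexField.Normc.normc R).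

Lemma normr_normc x : `|x| = (normc x)%:C.
Proof. by case: x. Qed.

Lemma normc_ge0 x : 0 <= normc x.
Proof. by case: x => a b; rewrite sqrtr_ge0. Qed.

Lemma normcD x y : normc (x + y) <= normc x + normc y.
Proof. by rewrite -lecR rmorphD /= -!normr_normc ler_normD. Qed.

Lemma normcB x y : normc (x - y) = normc (y - x).
Proof. by apply: complexI; rewrite -!normr_normc distrC. Qed.

Lemma normc_nonneg x : 0 <= x -> x = (normc x)%:C.
Proof. by move=> x0; rewrite -normr_normc ger0_norm. Qed.

Lemma normc_sum (I : Type) (r : seq I) (F : I -> R[i]) :
  normc (\sum_(i <- r) F i) <= \sum_(i <- r) normc (F i).
Proof.
elim/big_rec2: _ => [|i u v _ uv]; first by rewrite ComplexField.Normc.normc0.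
by rewrite (le_trans (normcD _ _))// lerD2l.
Qed.

End Normc.

Section SeminormTopology.
Variables (R : realType) (E : lmodType R[i]) (p : nat -> E -> R).
Local Notation normc := (@ComplexField.Normc.normc R).

(* Finite intersections of balls of the seminorms; if [p] increases with [k],
   this is the ball of radius [e] of [p k]. *)
Definition sn_ball (x : E) (ke : nat * R) : set E :=
  [set y | forall j, (j <= ke.1)%N -> p j (y - x) < ke.2].

Definition sn_nbhs (x : E) : set_system E :=
  filter_from [set ke : nat * R | 0 < ke.2] (sn_ball x).

Hypothesis p_ge0 : forall k x, 0 <= p k x.
Hypothesis pD : forall k x y, p k (x + y) <= p k x + p k y.
Hypothesis pZ : forall k a x, p k (a *: x) = normc a * p k x.

Let p0 k : p k 0 = 0.
Proof. by rewrite -(scale0r 0) pZ ComplexField.Normc.normc0 mul0r. Qed.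

Let ptri k x y z : p k (x - z) <= p k (x - y) + p k (y - z).
Proof. by rewrite (le_trans _ (pD _ _ _))// addrA subrK. Qed.

Lemma sn_ball_center x k e : 0 < e -> sn_ball x (k, e) x.
Proof. by move=> e0 j _ /=; rewrite subrr p0. Qed.

Lemma sn_ball_inner x k e y : sn_ball x (k, e) y ->
  exists2 d, 0 < d & sn_ball y (k, d) `<=` sn_ball x (k, e).
Proof.
move=> xy.
suff [d d0 dP] : exists2 d, 0 < d & forall j, (j <= k)%N -> p j (y - x) + d <= e.
  exists d => // z yz j jk /=; rewrite (le_lt_trans (ptri j z y x))//.
  by rewrite (lt_le_trans _ (dP j jk))// addrC ltrD2l; exact: yz.
have : forall j, (j <= k)%N -> p j (y - x) < e by exact: xy.
elim: k {xy} => [|k ih] xy.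
  exists (e - p 0%N (y - x)); first by rewrite subr_gt0 xy.
  by move=> j; rewrite leqn0 => /eqP ->; rewrite addrC subrK.
have [j jk|d d0 dP] := ih; first by rewrite xy// (leq_trans jk).
exists (Num.min d (e - p k.+1 (y - x))).
  by rewrite lt_min d0 subr_gt0 xy.
move=> j; rewrite leq_eqVlt => /predU1P[->|jk].
  by rewrite -lerBrDl ge_min lexx orbT.
by rewrite (le_trans _ (dP j jk))// lerD2l ge_min lexx.
Qed.

Lemma sn_nbhs_filter x : ProperFilter (sn_nbhs x).
Proof.
split.
  by move=> [[k e]/= e0] /(_ x); apply; exact: sn_ball_center.
apply: filter_from_filter; first by exists (0%N, 1); rewrite /= ltr01.
move=> [k e] [l f] /= e0 f0; exists (maxn k l, Num.min e f).
  by rewrite /= lt_min e0.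
move=> y xy; split=> j /= jk.
  have := xy j; rewrite /= leq_max jk => /(_ isT) /lt_le_trans; apply.
  by rewrite ge_min lexx.
have := xy j; rewrite /= leq_max jk orbT => /(_ isT) /lt_le_trans; apply.
by rewrite ge_min lexx orbT.
Qed.

Lemma sn_nbhs_singleton x (A : set E) : sn_nbhs x A -> A x.
Proof. by move=> [[k e]/= e0]; apply; exact: sn_ball_center. Qed.

Lemma sn_nbhs_nbhs x (A : set E) : sn_nbhs x A -> sn_nbhs x (sn_nbhs^~ A).
Proof.
move=> [[k e]/= e0 xA]; exists (k, e) => // y /sn_ball_inner[d d0 yd].
by exists (k, d) => //; exact: subset_trans xA.
Qed.

Lemma sn_bounded x k : exists2 M, 0 < M & forall j, (j <= k)%N -> p j x <= M.
Proof.
exists (1 + \sum_(j < k.+1) p j x).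
  by rewrite ltr_pwDl// sumr_ge0.
move=> j jk; rewrite (bigD1 (Ordinal (jk : (j < k.+1)%N)))//= addrCA lerDl.
by rewrite addr_ge0// sumr_ge0.
Qed.

Lemma sn_add x y A : sn_nbhs (x + y) A ->
  exists2 UV : set E * set E, sn_nbhs x UV.1 /\ sn_nbhs y UV.2 &
    forall u v, UV.1 u -> UV.2 v -> A (u + v).
Proof.
move=> [[k e]/= e0 xyA].
have e20 : 0 < e / 2 by rewrite divr_gt0.
exists (sn_ball x (k, e / 2), sn_ball y (k, e / 2)).
  by split; exists (k, e / 2).
move=> u v xu yv; apply: xyA => j jk /=.
rewrite opprD addrACA (le_lt_trans (pD _ _ _))// [ltRHS]splitr.
by rewrite ltrD//; [exact: xu|exact: yv].
Qed.

Lemma sn_scale (a : R[i]) x A : sn_nbhs (a *: x) A ->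
  exists2 dV : R * set E, 0 < dV.1 /\ sn_nbhs x dV.2 &
    forall b v, normc (a - b) < dV.1 -> dV.2 v -> A (b *: v).
Proof.
move=> [[k e]/= e0 axA].
have [M0 M0gt0 xM0] := sn_bounded x k.
pose M := M0 + normc a + 1.
have M_gt0 : 0 < M by rewrite addr_gt0// ltr_pwDl// normc_ge0.
have d0 : 0 < e / (2 * M) by rewrite divr_gt0// mulr_gt0.
have dM : M * (e / (2 * M)) = e / 2.
  by rewrite invfM mulrA mulrAC mulrCA mulrA mulfK ?gt_eqF// mulrC.
exists (Num.min 1 (e / (2 * M)), sn_ball x (k, e / (2 * M))).
  by split; [rewrite /= lt_min ltr01|exists (k, e / (2 * M))].
move=> b v /=; rewrite lt_min => /andP[ab1 abd] xv; apply: axA => j jk /=.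
have -> : b *: v - a *: x = b *: (v - x) + (b - a) *: x.
  by rewrite scalerBr scalerBl addrA subrK.
rewrite (le_lt_trans (pD _ _ _))// !pZ [ltRHS]splitr ltr_leD//.
  have bM : normc b <= M.
    rewrite -[b](subrK a) addrC (le_trans (normcD _ _))// normcB.
    by rewrite /M (addrC M0) -addrA lerD2l ler_wpDl// ltW.
  rewrite -dM (le_lt_trans (ler_wpM2r _ bM))// ltr_pM2l//.
  exact: xv.
rewrite normcB -dM mulrC ler_pM ?normc_ge0 ?(ltW abd)//.
rewrite (le_trans (xM0 _ jk))// /M -addrA lerDl addr_ge0//.
exact: normc_ge0.
Qed.

Lemma sn_ball_convex x ke (y z : E) (l : R[i]) : 0 <= l -> l <= 1 ->
  sn_ball x ke y -> sn_ball x ke z -> sn_ball x ke (l *: y + (1 - l) *: z).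
Proof.
move=> l0 l1 xy xz j jk.
pose t := normc l.
have tE : l = t%:C by exact: normc_nonneg.
have t1 : t <= 1 by rewrite -lecR -tE.
have t0 : 0 <= t by exact: normc_ge0.
have uE : normc (1 - l) = 1 - t.
  apply: complexI; rewrite -normr_normc ger0_norm ?subr_ge0//.
  by rewrite tE rmorphB.
have -> : l *: y + (1 - l) *: z - x = l *: (y - x) + (1 - l) *: (z - x).
  rewrite !scalerBr addrACA -opprD -scalerDl.
  by rewrite [X in X *: x](_ : _ = 1) ?scale1r// addrC subrK.
rewrite (le_lt_trans (pD _ _ _))// !pZ uE -/t.
have split_t (u : R) : u = t * u + (1 - t) * u by rewrite -mulrDl addrC subrK mul1r.
have [te|te] := lerP (p j (y - x)) (p j (z - x)).
  rewrite (le_lt_trans _ (xz j jk))// [leRHS]split_t.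
  by rewrite lerD2r ler_wpM2l.
rewrite (le_lt_trans _ (xy j jk))// [leRHS]split_t.
by rewrite lerD2l ler_wpM2l ?subr_ge0// ltW.
Qed.

End SeminormTopology.

Section PowerSeriesSpace.
Variables (R : realType) (alpha : nat -> R).
Local Notation normc := (@ComplexField.Normc.normc R).

(* Indices are shifted: [k : nat] and [n : nat] stand for the indices [k.+1]
   and [n.+1] of the usual notation, where N starts at 1. *)
Definition weight (k n : nat) : R := expR (- (alpha n / k.+1%:R)).

Definition in_Lambda0 (x : nat -> R[i]) : Prop :=
  forall k, (fun n => weight k n * normc (x n)) @ \oo --> (0 : R).

Definition Lambda0_pred : {pred nat -> R[i]} := fun x => `[< in_Lambda0 x >].

Record Lambda0 := MkLambda0 {
  Lambda0_val :> nat -> R[i] ;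
  _ : Lambda0_val \in Lambda0_pred }.

Lemma weight_ge0 k n : 0 <= weight k n.
Proof. exact: expR_ge0. Qed.

Lemma in_Lambda0_submod : submod_closed Lambda0_pred.
Proof.
split=> [|a x y /asboolP xL /asboolP yL]; apply/asboolP => k.
  rewrite (_ : (fun _ => _) = cst 0); first exact: cvg_cst.
  by apply/funext => n; rewrite (_ : 0 n = 0 :> R[i])// ComplexField.Normc.normc0 mulr0.
have h : (fun n => normc a * (weight k n * normc (x n)) +
                   weight k n * normc (y n)) @ \oo --> (0 : R).
  rewrite -[0]addr0 -[X in X + _](mulr0 (normc a)).
  by apply: cvgD; [apply: cvgZr; exact: xL|exact: yL].
apply: (squeeze_cvgr _ (cvg_cst 0) h).
apply: nearW => n /=; rewrite mulr_ge0 ?weight_ge0 ?normc_ge0//=.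
rewrite mulrCA -mulrDr ler_wpM2l ?weight_ge0//.
by rewrite -ComplexField.Normc.normcM normcD.
Qed.

HB.instance Definition _ := GRing.isSubmodClosed.Build R[i] (nat -> R[i])
  Lambda0_pred in_Lambda0_submod.
HB.instance Definition _ := [isSub for Lambda0_val].
HB.instance Definition _ := [Choice of Lambda0 by <:].
HB.instance Definition _ := [SubChoice_isSubLmodule of Lambda0 by <:].

Lemma Lambda0P (x : Lambda0) : in_Lambda0 x.
Proof. by have /asboolP := valP x. Qed.

Definition Lambda0_norm (k : nat) (x : Lambda0) : R :=
  sup (range (fun n => weight k n * normc (x n))).

Lemma Lambda0_has_ubound k (x : Lambda0) :
  has_ubound (range (fun n => weight k n * normc (x n))).
Proof.
have /cvg_seq_bounded[M [_ MP]] : cvgn (fun n => weight k n * normc (x n)).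
  by apply/cvg_ex; exists 0; exact: Lambda0P.
exists (M + 1) => _ [n _ <-].
rewrite (le_trans (ler_norm _))//.
by apply: (MP (M + 1)) => //; rewrite ltrDl.
Qed.

Lemma Lambda0_norm_ub k (x : Lambda0) n :
  weight k n * normc (x n) <= Lambda0_norm k x.
Proof. by apply: ub_le_sup; [exact: Lambda0_has_ubound|exists n]. Qed.

Lemma Lambda0_norm_le k (x : Lambda0) c :
  (forall n, weight k n * normc (x n) <= c) -> Lambda0_norm k x <= c.
Proof.
move=> xc; apply: ge_sup; first by exists (weight k 0%N * normc (x 0%N)), 0%N.
by move=> _ [n _ <-].
Qed.

Lemma Lambda0_norm_ge0 k x : 0 <= Lambda0_norm k x.
Proof.
by rewrite (le_trans _ (Lambda0_norm_ub k x 0%N))// mulr_ge0 ?weight_ge0 ?normc_ge0.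
Qed.

Lemma Lambda0_normD k x y :
  Lambda0_norm k (x + y) <= Lambda0_norm k x + Lambda0_norm k y.
Proof.
apply: Lambda0_norm_le => n.
rewrite (le_trans _ (lerD (Lambda0_norm_ub k x n) (Lambda0_norm_ub k y n)))//.
by rewrite -mulrDr ler_wpM2l ?weight_ge0// normcD.
Qed.

Lemma Lambda0_normZ k a x :
  Lambda0_norm k (a *: x) = normc a * Lambda0_norm k x.
Proof.
have le b y : Lambda0_norm k (b *: y) <= normc b * Lambda0_norm k y.
  apply: Lambda0_norm_le => n.
  rewrite (_ : (b *: y) n = b * y n)// ComplexField.Normc.normcM mulrCA.
  by rewrite ler_wpM2l ?normc_ge0// Lambda0_norm_ub.
apply/eqP; rewrite eq_le le/=.
have [->|a0] := eqVneq a 0.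
  by rewrite ComplexField.Normc.normc0 mul0r Lambda0_norm_ge0.
have na : 0 < normc a.
  by rewrite lt_neqAle normc_ge0 andbT eq_sym; apply: contra_neq a0;
     exact: ComplexField.Normc.eq0_normc.
rewrite -ler_pdivlMl// -ComplexField.Normc.normcV.
by rewrite -[in leLHS](scale1r x) -(mulVf a0) -scalerA le.
Qed.

HB.instance Definition _ := hasNbhs.Build Lambda0 (sn_nbhs Lambda0_norm).

HB.instance Definition _ := Nbhs_isNbhsTopological.Build Lambda0
  (sn_nbhs_filter Lambda0_normZ)
  (sn_nbhs_singleton Lambda0_normZ)
  (sn_nbhs_nbhs Lambda0_normD).

Let Lambda0_add_continuous : continuous (fun x : Lambda0 * Lambda0 => x.1 + x.2).
Proof.
move=> [x y] A /= /(sn_add Lambda0_normD)[[U V]/= [xU yV] UVA].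
by exists (U, V) => //= -[u v] [/=]; exact: UVA.
Qed.

Let Lambda0_scale_continuous :
  continuous (fun x : R[i]^o * Lambda0 => x.1 *: x.2).
Proof.
move=> [a x] A /= /(sn_scale Lambda0_norm_ge0 Lambda0_normD Lambda0_normZ).
move=> [[d V]/= [d0 xV] dVA].
exists ([set b | normc (a - b) < d], V) => /=.
  split => //; exists d%:C; first by rewrite /= ltcR.
  by move=> b; rewrite /ball_/= normr_normc ltcR.
by move=> [b v] [/=]; exact: dVA.
Qed.

Let Lambda0_locally_convex : exists2 B : set_system (convex_lmodType Lambda0),
  (forall b, b \in B -> convex_set b) & basis B.
Proof.
exists [set B | exists x ke, B = sn_ball Lambda0_norm x ke].
  move=> _ /[!inE] -[x [ke ->]] y z l /[!inE] xy xz.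
  apply: (sn_ball_convex Lambda0_normD Lambda0_normZ) => //.
split.
  move=> _ [x [[k e] ->]]; rewrite openE => y.
  move=> /(sn_ball_inner Lambda0_normD)[d d0 yd]; by exists (k, d).
move=> x U [[k e] e0 xU]; exists (sn_ball Lambda0_norm x (k, e)) => //.
by split; [exists x, (k, e)|exact: (sn_ball_center Lambda0_normZ)].
Qed.

(* This factory only installs the uniform structure. *)
HB.instance Definition _ := PreTopologicalLmod_isTvs.Build R[i] Lambda0
  Lambda0_add_continuous Lambda0_scale_continuous Lambda0_locally_convex.
HB.instance Definition _ :=
  PreTopologicalNmodule_isTopologicalNmodule.Build Lambda0
    Lambda0_add_continuous.
HB.instance Definition _ :=
  TopologicalNmodule_isTopologicalLmodule.Build R[i] Lambda0
    Lambda0_scale_continuous.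
HB.instance Definition _ :=
  Uniform_isTvs.Build R[i] Lambda0 Lambda0_locally_convex.

End PowerSeriesSpace.


Section CesaroOperator.
Variables (R : realType) (alpha : nat -> R).
Local Notation normc := (@ComplexField.Normc.normc R).

Definition increasing_to_oo : Prop :=
  [/\ forall n, 1 < alpha n,
      forall n, alpha n < alpha n.+1 &
      alpha @ \oo --> +oo].

Lemma arithmetic_mean_Lambda0 (x : Lambda0 alpha) : increasing_to_oo ->
  (arithmetic_mean x : nat -> R[i]) \in Lambda0_pred alpha.
Proof.
move=> [_ inc _]; apply/asboolP => k.
have wd i n : (i <= n)%N -> weight alpha k n <= weight alpha k i.
  move=> ien; rewrite ler_expR lerN2 ler_wpM2r ?invr_ge0//.
  have : {homo alpha : m n / (m <= n)%N >-> m <= n}.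
    by apply: (homo_leq (@lexx _ _) (@le_trans _ _)) => m; exact: ltW.
  exact.
have /cesaro h := Lambda0P x k.
apply: (squeeze_cvgr _ (cvg_cst 0) h); apply: nearW => n /=.
rewrite mulr_ge0 ?weight_ge0 ?normc_ge0//=.
rewrite ComplexField.Normc.normcM mulrCA.
have -> : normc (n.+1%:R^-1) = n.+1%:R^-1.
  rewrite ComplexField.Normc.normcV; congr _^-1; apply: complexI.
  by rewrite -normr_normc normr_nat rmorph_nat.
rewrite ler_wpM2l ?invr_ge0// /series/=.
rewrite (le_trans (ler_wpM2l (weight_ge0 _ _ _) (normc_sum _ _)))//.
rewrite mulr_sumr ler_sum_nat// => i /andP[_ ilt].
by rewrite ler_wpM2r ?normc_ge0// wd.
Qed.

Definition cesaro_op (halpha : increasing_to_oo) (x : Lambda0 alpha) :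
  Lambda0 alpha := MkLambda0 (arithmetic_mean_Lambda0 x halpha).

End CesaroOperator.

(* Main.v *)
Require Import Defs.
From mathcomp Require Import all_boot all_order all_algebra complex.
From mathcomp Require Import all_classical all_reals all_analysis.
Import Order.TTheory GRing.Theory Num.Theory numFieldNormedType.Exports.

(** Indices start at 0. The claim holds because every power of [I - C] has the
    same range, the closed hyperplane [{y | y 0 = 0}].

    The inclusion is immediate, since [(C x) 0 = x 0]. For the converse, the
    equation [(I - C) x = y] with [y 0 = 0] is solved on all sequences: if [A n]
    is the [n]-th mean of [x], then [y n = x n - A n = n * (A n - A (n - 1))],
    so that, after normalizing [x 0 = 0], [x n = y n + \sum_(1 <= j <= n) y j / j].
    As this solution lies again in the hyperplane, it can be iterated. Nuclearity
    enters only to show that it stays in the space. If [y] grows at most like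
    [1 / w_l n], the sum grows at most like [n / w_l n], which is harmless as soon
    as [n * w_l n] is bounded for every [l].

    That bound follows from the summability of [n |-> w_k n] for all [k]
    ([nuclear_weight_summable]), the weights being nonincreasing in [n]. The
    summability is a trace computation. Up to a small error the linking map is a
    sum of rank one operators [x |-> l_i * g_i(x) *: z_i], with
    [\sum_i `|l_i| <= L], [`|g_i|] at most [C] times the [l]-th norm and [z_i] of
    [k]-th norm at most 2 ([nuclear_finite_rank]). Reading the diagonal entries
    on the unit vectors [e_n] and scaling by [w_k n / w_l n] gives
    [\sum_n w_k n / w_l n <= \sum_i `|l_i * g_i(\sum_n c_in *: e_n)| + 1], where
    [`|c_in| * w_l n <= 2]. As the norms are weighted sup norms, each vector
    [\sum_n c_in *: e_n] has [l]-th norm at most 2 however many terms it has, and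
    the right-hand side is at most [2 * C * L + 1]. *)

Local Open Scope classical_set_scope.
Local Open Scope ring_scope.

(** * Finite rank approximation of nuclear linking maps *)

Section FiniteRankApproximation.
Context {K : numFieldType} {E : lmodType K}.

Lemma dense_ball (B : normedModType K) (j : E -> B) (y : B) (eta : K) :
  dense (range j) -> 0 < eta -> exists z, `|y - j z| < eta.
Proof.
move=> dj eta0.
have [||v [/= yv [z _ zE]]] := dj (ball y eta).
- by exists y; exact: ballxx.
- exact: ball_open.
by exists z; move: yv; rewrite -zE -ball_normE.
Qed.

(** The nuclear expansion of [T] involves functionals on [Bq] and vectors of
    [Bp]. Pulling the former back along [jq] and replacing finitely many of the
    latter by vectors of the dense range of [jp] expresses everything in [E],
    so that no functional has to be extended to a completion. The replacement
    costs the bound 2 instead of 1 on the vectors. What matters is that [L] is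
    chosen before the finite family [e] and the precision [d]. *)
Lemma nuclear_finite_rank {p q : E -> K} {Bq Bp : completeNormedModType K}
    {jq : {linear E -> Bq}} {jp : {linear E -> Bp}} {T : {linear Bq -> Bp}} :
  local_banach q jq -> local_banach p jp -> (forall x, T (jq x) = jp x) ->
  nuclear_map T ->
  exists2 L : K, 0 <= L &
    forall (N : nat) (e : 'I_N -> E) (d : K), 0 < d ->
    exists (r : nat) (l : 'I_r -> K) (g : 'I_r -> {linear E -> K^o})
           (z : 'I_r -> E),
      [/\ \sum_i `|l i| <= L,
          forall i x, `|g i x| <= q x,
          forall i, p (z i) <= 2 &
          forall n, p (e n - \sum_i (l i * g i (e n)) *: z i) <= d].
Proof.
move=> [jqE _] [jpE jpd] TE [l [f [y [lcvg f1 y1 Tcvg]]]].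
have q0 x : 0 <= q x by rewrite -jqE.
have [L [Lr Lbd]] := cvg_seq_bounded lcvg.
exists (`|L| + 1); first by rewrite addr_ge0.
move=> N e d d0.
have d20 : 0 < d / 2 by rewrite divr_gt0.
have [r rP] : exists r, forall n,
    `|T (jq (e n)) - \sum_(i < r) (l i * f i (jq (e n))) *: y i| <= d / 2.
  have /filter_ex[r rP] : \forall r \near \oo, forall n : 'I_N,
      `|T (jq (e n)) - series (fun i => (l i * f i (jq (e n))) *: y i) r|
        <= d / 2.
    apply: filter_forall => n; have := Tcvg (jq (e n)).
    by move=> /cvgr_dist_le; apply.
  by exists r => n; have := rP n; rewrite /series/= big_mkord.
pose S := \sum_(i < r) \sum_(n < N) `|l i| * q (e n).
have S0 : 0 <= S.
  by apply: sumr_ge0 => i _; apply: sumr_ge0 => n _; rewrite mulr_ge0.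
(* [eta <= 1] and [S * eta <= d / 2] hold together without taking a minimum,
   which the partial order of [K] makes awkward. *)
pose eta := d / (d + 2 * S).
have den0 : 0 < d + 2 * S by rewrite ltr_pwDl// mulr_ge0.
have eta0 : 0 < eta by rewrite divr_gt0.
have eta1 : eta <= 1 by rewrite ler_pdivrMr// mul1r lerDl mulr_ge0.
have Seta : S * eta <= d / 2.
  rewrite mulrA ler_pdivrMr// mulrDr -[leLHS]add0r.
  rewrite lerD ?mulr_ge0 ?(ltW d0) ?(ltW d20)//.
  by rewrite mulrA divfK ?pnatr_eq0// mulrC.
have /choice[z zP] : forall i : 'I_r, exists z, `|y i - jp z| < eta.
  by move=> i; exact: dense_ball.
exists r, (fun i => l i), (fun i : 'I_r => f i \o jq : {linear E -> K^o}), z.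
split.
- have := Lbd (`|L| + 1); rewrite (le_lt_trans (real_ler_norm Lr)) ?ltrDl//.
  move=> /(_ isT r I); rewrite /= /series/= big_mkord ger0_norm//.
  exact: sumr_ge0.
- by move=> i x /=; rewrite -jqE.
- move=> i; rewrite -jpE -[jp _](subrK (y i)) (le_trans (ler_normD _ _))//.
  by rewrite -[leRHS]/(1 + 1) lerD// distrC (le_trans (ltW (zP i))).
- move=> n; rewrite -jpE raddfB raddf_sum/= -TE.
  rewrite -(subrKA (\sum_(i < r) (l i * f i (jq (e n))) *: y i)).
  rewrite (le_trans (ler_normD _ _))// [leRHS]splitr lerD//.
  rewrite -sumrB (le_trans (ler_norm_sum _ _ _))// (le_trans _ Seta)//.
  rewrite mulr_suml ler_sum// => i _.
  rewrite linearZ/= -scalerBr normrZ ler_pM ?(ltW (zP i))//.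
  rewrite normrM (bigD1 n)//= -[leLHS]addr0 lerD ?ler_wpM2l//.
    by rewrite -jqE.
  by rewrite sumr_ge0// => ? _; rewrite mulr_ge0.
Qed.

End FiniteRankApproximation.

(** * Weights and continuous seminorms of the power series space *)

Section CesaroOnPowerSeriesSpace.
Local Open Scope complex_scope.

Lemma normcR {R : rcfType} (x : R) : ComplexField.Normc.normc x%:C = `|x|.
Proof. by rewrite /ComplexField.Normc.normc/= expr0n/= addr0 sqrtr_sqr. Qed.

Context {R : realType} {alpha : nat -> R}.
Hypothesis halpha : increasing_to_oo alpha.
Local Notation normc := (@ComplexField.Normc.normc R).
Local Notation w := (weight alpha).
Local Notation Lam := (Lambda0 alpha).

Lemma alpha_gt0 n : 0 < alpha n.
Proof. by case: halpha => /(_ n) /(lt_trans ltr01). Qed.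

Lemma weight_gt0 k n : 0 < w k n.
Proof. exact: expR_gt0. Qed.

Lemma weight_le1 k n : w k n <= 1.
Proof. by rewrite -expR0 ler_expR oppr_le0 divr_ge0// ltW ?alpha_gt0. Qed.

Lemma weight_nonincreasing k i n : (i <= n)%N -> w k n <= w k i.
Proof.
move=> ien; rewrite ler_expR lerN2 ler_wpM2r ?invr_ge0//.
have [_ inc _] := halpha.
have : {homo alpha : m n / (m <= n)%N >-> m <= n}.
  by apply: (homo_leq (@lexx _ _) (@le_trans _ _)) => m; exact: ltW.
exact.
Qed.

Lemma weight_nondecreasing j k n : (j <= k)%N -> w j n <= w k n.
Proof.
move=> jk; rewrite ler_expR lerN2 ler_wpM2l ?(ltW (alpha_gt0 n))//.
by rewrite lef_pV2 ?posrE ?ltr0n// ler_nat.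
Qed.

(** Index [k] stands for the exponent [- alpha n / (k + 1)], and
    [(3 * k + 2) + 1 = 3 * (k + 1)]. One factor of the cube will absorb the growth
    of a sequence, one the number of terms of a sum, and one tends to 0. *)
Lemma weight_cube k n : w (3 * k + 2) n ^+ 3 = w k n.
Proof.
rewrite /weight -expRM_natr; congr expR.
rewrite mulNr -mulrA; congr (- (_ * _)).
rewrite (_ : (3 * k + 2).+1 = 3 * k.+1)%N; last by rewrite mulnS -addnS addnC.
by rewrite natrM invfM mulrAC mulVf ?mul1r// pnatr_eq0.
Qed.

Lemma Lambda0_norm_nondecreasing j k (x : Lam) :
  (j <= k)%N -> Lambda0_norm j x <= Lambda0_norm k x.
Proof.
move=> jk; apply: Lambda0_norm_le => n.
by rewrite (le_trans _ (Lambda0_norm_ub k x n))// ler_wpM2r ?normc_ge0//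
  weight_nondecreasing.
Qed.

Lemma Lambda0_norm_continuous_seminorm k :
  continuous_seminorm
    (fun x : (Lam : tvsType R[i]) => (Lambda0_norm k x)%:C).
Proof.
split; first split.
- by move=> x; rewrite lecR Lambda0_norm_ge0.
- by move=> x y; rewrite -rmorphD lecR Lambda0_normD.
- by move=> a x; rewrite Lambda0_normZ rmorphM/= normr_normc.
move=> x.
apply/(@cvgrPdist_lt _ _ _ (nbhs (x : Lam)) (nbhs_filter x)) => e.
move=> e0; have eE : e = (normc e)%:C by apply: normc_nonneg; exact: ltW.
have e0' : 0 < normc e by move: e0; rewrite {1}eE ltcR.
exists (k, normc e) => //= y xy /=.
rewrite eE -rmorphB normr_normc ltcR normcR.
have le (u v : Lam) : Lambda0_norm k u - Lambda0_norm k v <= Lambda0_norm k (u - v).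
  by rewrite lerBlDr -[in leLHS](subrK v u) Lambda0_normD.
rewrite distrC (le_lt_trans _ (xy k (leqnn k)))// ler_norml le andbT.
rewrite lerNl opprB; apply: le_trans (le _ _) _.
by rewrite -[x - y]opprB -(scaleN1r (y - x)) Lambda0_normZ -[-1 in leLHS]sub0r normcB
  subr0 ComplexField.Normc.normc1 mul1r.
Qed.

(** The unit ball of [q] contains a ball of radius [e] of the [l]-th norm;
    homogeneity extends the comparison to all vectors. *)
Lemma continuous_seminorm_le (q : Lam -> R[i]) :
  continuous_seminorm (q : (Lam : tvsType R[i]) -> _) ->
  exists l, exists2 M, 0 < M & forall x : Lam, q x <= (M * Lambda0_norm l x)%:C.
Proof.
move=> [[q0 qD qZ] qc].
have q00 : q 0 = 0 by rewrite -(scale0r 0) qZ normr0 mul0r.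
have [[l e]/= e0 ball1] : nbhs (0 : Lam) [set x | `|q 0 - q x| < 1].
  by have /cvgrPdist_lt/(_ 1 ltr01) := qc 0.
exists l, (2 / e); first by rewrite divr_gt0.
(* [x] is scaled into the ball by [e / (2 * (M + t))]; the slack [t] keeps this
   factor well defined when [M = 0]. *)
move=> x; set M := Lambda0_norm l x.
have M0 : 0 <= M by exact: Lambda0_norm_ge0.
have main t : 0 < t -> q x <= (2 / e * (M + t))%:C.
  move=> t0; pose s := e / (2 * (M + t)).
  have Mt0 : 0 < M + t by rewrite ltr_wpDl.
  have s0 : 0 < s by rewrite divr_gt0// mulr_gt0.
  have qs : s%:C * q x <= 1.
    apply: ltW.
    have /= := ball1 (s%:C *: x).
    rewrite q00 sub0r normrN qZ !ger0_norm ?mulr_ge0 ?ler0c ?(ltW s0)//.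
    apply=> j jl /=; rewrite subr0 Lambda0_normZ.
    rewrite normcR gtr0_norm//.
    rewrite (@le_lt_trans _ _ (s * M)) ?ler_wpM2l ?(ltW s0)//.
      exact: Lambda0_norm_nondecreasing.
    rewrite /s mulrAC ltr_pdivrMr ?mulr_gt0// ltr_pM2l//.
    by rewrite (@lt_le_trans _ _ (M + t)) ?ltrDl// ler_peMl ?(ltW Mt0) ?ler1n.
  rewrite (_ : 2 / e * (M + t) = s^-1); last by rewrite /s invf_div mulrAC.
  by rewrite rmorphV ?unitfE ?gt_eqF//= -[leRHS]mulr1 ler_pdivlMl// ltcR.
rewrite [q x](normc_nonneg (q0 x)) lecR; apply/ler_addgt0Pr => t t0.
have := main (e / 2 * t); rewrite mulr_gt0 ?divr_gt0// => /(_ isT).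
rewrite {1}(normc_nonneg (q0 x)) lecR mulrDr -{2}(invf_div e 2).
by rewrite mulKf// gt_eqF// divr_gt0.
Qed.

(** * Nuclearity makes the weights summable *)

Lemma Lambda0_sum_coord (I : finType) (F : I -> Lam) i :
  (\sum_j F j : Lam) i = \sum_j F j i.
Proof. exact: (big_morph (fun x : Lam => x i)). Qed.

Lemma unit_vector_subproof n :
  (fun i => (i == n)%:R : R[i]) \in Lambda0_pred alpha.
Proof.
apply/asboolP => k; apply: cvg_near_cst; exists n.+1 => // i /= ni.
by rewrite gtn_eqF// ComplexField.Normc.normc0 mulr0.
Qed.

Definition unit_vector n : Lam := MkLambda0 (unit_vector_subproof n).

(** The bound does not depend on the number of terms, which is what distinguishes
    a weighted sup norm and makes the trace argument work. *)
Lemma Lambda0_norm_finite_sum l N (c : 'I_N -> R[i]) (B : R) : 0 <= B ->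
  (forall n : 'I_N, w l n * normc (c n) <= B) ->
  Lambda0_norm l (\sum_n c n *: unit_vector n) <= B.
Proof.
move=> B0 cB; apply: Lambda0_norm_le => i; rewrite Lambda0_sum_coord.
have [iN|Ni] := ltnP i N.
  rewrite (bigD1 (Ordinal iN))//= big1 => [|j ji]; last first.
    rewrite -[LHS]/(c j * (i == j)%:R) [i == j](_ : _ = false) ?mulr0//.
    by apply/negbTE; apply: contra ji => /eqP ij; apply/eqP/val_inj.
  rewrite addr0 -[X in normc X]/(c (Ordinal iN) * (i == i)%:R) eqxx mulr1.
  exact: cB (Ordinal iN).
rewrite big1 ?ComplexField.Normc.normc0 ?mulr0// => j _.
rewrite -[LHS]/(c j * (i == j)%:R) [i == j](_ : _ = false) ?mulr0//.
by rewrite gtn_eqF// (leq_trans (ltn_ord j)).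
Qed.

(** The trace, over the first [N] coordinates, of the finite rank operator that
    approximates the identity is computed in two ways: coordinate by coordinate
    it is almost [\sum_n w k n / w l n], which dominates [\sum_n w k n], and
    rank one term by rank one term it is at most [L * (C * 2)]. *)
Lemma nuclear_weight_summable k :
  nuclear_space (Lam : tvsType R[i]) ->
  exists M : R, forall N, \sum_(n < N) w k n <= M.
Proof.
move=> /(_ _ (Lambda0_norm_continuous_seminorm k)).
move=> [q [qcont _ [Bq [Bp [jq [jp [T [Hq Hp TE nT]]]]]]]].
have [L L0 approx] := nuclear_finite_rank Hq Hp TE nT.
have [l [C C0 qC]] := continuous_seminorm_le _ qcont.
pose M := 1 + L * (C * 2)%:C.
have M0 : 0 <= M by rewrite addr_ge0// mulr_ge0// ler0c mulr_ge0// ltW.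
exists (normc M) => N.
pose v n : R := w l n.
have v0 n : 0 < v n by exact: weight_gt0.
(* [S^-1] is a precision whose total cost, once divided by the weights, is at
   most 1. *)
pose S := 1 + \sum_(n < N) (v n)^-1.
have S0 : 0 < S by rewrite ltr_pwDl// sumr_ge0// => n _; rewrite invr_ge0 ltW.
have d0 : 0 < S^-1%:C :> R[i] by rewrite ltcR invr_gt0.
have [r [lam [g [z [lamL gq z2 err]]]]] :=
  approx N (fun n => unit_vector n) _ d0.
rewrite -lecR -normc_nonneg// rmorph_sum/=.
(* [a n] is the weighted [n]-th diagonal entry of the approximation error. *)
pose a n := (w k n)%:C * (1 - \sum_i lam i * g i (unit_vector n) * z i n).
have aS n : (n < N)%N -> `|a n| <= S^-1%:C.
  move=> nN; apply: le_trans (err (Ordinal nN)).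
  rewrite normr_normc lecR; apply: le_trans (Lambda0_norm_ub k _ n).
  rewrite ComplexField.Normc.normcM.
  have -> : 1 - \sum_i lam i * g i (unit_vector n) * z i n =
      (unit_vector n - \sum_i (lam i * g i (unit_vector n)) *: z i : Lam) n.
    rewrite -[RHS]/((n == n)%:R -
      (\sum_i (lam i * g i (unit_vector n)) *: z i : Lam) n).
    by rewrite eqxx Lambda0_sum_coord.
  rewrite ler_wpM2r ?normc_ge0//.
  by rewrite normcR ger0_norm ?weight_ge0.
(* Merging the sums over [n] inside [g i] lets the sup norm control them. *)
pose c i n := ((w k n)%:C * z i n) / (v n)%:C.
have trace : \sum_(n < N) (w k n)%:C / (v n)%:C =
    \sum_(n < N) a n / (v n)%:C +
    \sum_i lam i * g i (\sum_(n < N) c i n *: unit_vector n).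
  under [X in _ + X]eq_bigr => i _ do rewrite raddf_sum mulr_sumr.
  rewrite exchange_big/= -big_split/=; apply: eq_bigr => n _.
  under eq_bigr => i _ do rewrite linearZ.
  rewrite /a mulrBr mulr1 mulrBl -[LHS]addr0 -addrA; congr (_ + _).
  apply/esym/eqP; rewrite addrC subr_eq0; apply/eqP.
  rewrite mulr_sumr mulr_suml; apply: eq_bigr => i _.
  rewrite -[X in lam i * X]/(c i n * g i (unit_vector n)) /c.
  by rewrite -!mulrA mulrCA; congr (_ * (_ * _)); rewrite mulrA mulrC.
apply: (@le_trans _ _ (\sum_(n < N) (w k n)%:C / (v n)%:C)).
  apply: ler_sum => n _; rewrite -fmorphV -rmorphM lecR ler_peMr ?weight_ge0//.
  by rewrite invf_ge1// weight_le1.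
rewrite -[leLHS]ger0_norm; last first.
  by apply: sumr_ge0 => n _; rewrite divr_ge0 ?ler0c ?weight_ge0 ?(ltW (v0 _)).
rewrite trace (le_trans (ler_normD _ _))// lerD//.
  rewrite (le_trans (ler_norm_sum _ _ _))//.
  apply: (@le_trans _ _ (\sum_(n < N) (S^-1 / v n)%:C)).
    apply: ler_sum => n _; rewrite normrM normfV rmorphM [X in _ <= _ * X]fmorphV/=.
    by rewrite (ger0_norm (x := (v n)%:C)) ?ler0c ?(ltW (v0 _))// ler_wpM2r
      ?aS ?invr_ge0 ?ler0c ?(ltW (v0 _)).
  rewrite -rmorph_sum lecR -mulr_sumr mulrC ler_pdivrMr// mul1r.
  by rewrite lerDr.
rewrite (le_trans (ler_norm_sum _ _ _))//.
apply: le_trans (ler_wpM2r _ lamL); last by rewrite ler0c mulr_ge0 ?ltW.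
rewrite mulr_suml; apply: ler_sum => i _; rewrite normrM ler_wpM2l//.
apply: le_trans (gq _ _) _; apply: le_trans (qC _) _.
rewrite lecR ler_wpM2l ?(ltW C0)//.
apply: Lambda0_norm_finite_sum => // n.
rewrite /c !ComplexField.Normc.normcM ComplexField.Normc.normcV.
rewrite !normcR !ger0_norm ?weight_ge0 ?(ltW (v0 _))// mulrCA mulfV ?gt_eqF// mulr1.
apply: le_trans (Lambda0_norm_ub k _ _) _.
by rewrite -lecR (le_trans (z2 i))// rmorph_nat.
Qed.

(** * The range of the powers of I - C *)

Section CesaroRange.
Hypothesis hnuclear : nuclear_space (Lam : tvsType R[i]).

Lemma nuclear_weight_bound k :
  exists M : R, forall n, n.+1%:R * w k n <= M.
Proof.
have [M MP] := nuclear_weight_summable k hnuclear.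
exists M => n; apply: le_trans (MP n.+1).
rewrite mulr_natl -[X in _ *+ X]card_ord -sumr_const; apply: ler_sum => i _.
by rewrite weight_nonincreasing// -ltnS.
Qed.

Lemma nuclear_weight_cvg0 k : w k n @[n --> \oo] --> (0 : R).
Proof.
have [M MP] := nuclear_weight_bound k.
have h : (M * (harmonic n : R)) @[n --> \oo] --> (0 : R).
  by rewrite -(mulr0 M); apply: cvgMr; exact: cvg_harmonic.
apply: (squeeze_cvgr _ (cvg_cst 0) h); apply: nearW => n /=.
by rewrite weight_ge0/= ler_pdivlMr// mulrC.
Qed.

(** The solution [x] of [x - C x = y] with [x 0 = 0]. The summand [j = 0] is
    [y 0 / 0 = 0], so the sum effectively starts at [j = 1]. *)
Definition cesaro_preimage (y : nat -> R[i]) : nat -> R[i] :=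
  fun n => y n + \sum_(j < n.+1) y j / j%:R.

(** Each of the [n + 1] terms of the sum is at most [C / w l n], since the weights
    are nonincreasing. With [w k n = w l n ^+ 3], the weighted sum is at most
    [((n + 1) * w l n) * C * w l n <= M * C * w l n], which tends to 0. *)
Lemma cesaro_preimage_subproof (y : Lam) :
  cesaro_preimage y \in Lambda0_pred alpha.
Proof.
apply/asboolP => k; pose l := (3 * k + 2)%N.
have [M MP] := nuclear_weight_bound l.
pose C := Lambda0_norm l y.
have C0 : 0 <= C by exact: Lambda0_norm_ge0.
have h : (fun n => w k n * normc (y n) + M * C * w l n)
    @ \oo --> (0 : R).
  rewrite -[0]addr0 -[X in _ + X](mulr0 (M * C)).
  apply: cvgD; first exact: Lambda0P.
  by apply: cvgMr; exact: nuclear_weight_cvg0.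
apply: (squeeze_cvgr _ (cvg_cst 0) h); apply: nearW => n /=.
rewrite mulr_ge0 ?weight_ge0 ?normc_ge0//=.
rewrite (le_trans (ler_wpM2l (weight_ge0 _ _ _) (normcD _ _)))//.
rewrite mulrDr lerD2l.
have yC (j : 'I_n.+1) : w l n * normc (y j / j%:R) <= C.
  have jn : (j <= n)%N by rewrite -ltnS.
  rewrite (le_trans _ (Lambda0_norm_ub l y j))//.
  rewrite ler_pM ?weight_ge0 ?normc_ge0 ?weight_nonincreasing//.
  rewrite ComplexField.Normc.normcM ler_piMr ?normc_ge0//.
  rewrite -(rmorph_nat (real_complex R)) -fmorphV normcR ger0_norm ?invr_ge0//.
  by case: (j : nat) => [|i]; rewrite ?invr0 ?invf_le1 ?ler1n.
have sC : w l n * normc (\sum_(j < n.+1) y j / j%:R) <= n.+1%:R * C.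
  rewrite (le_trans (ler_wpM2l (weight_ge0 _ _ _) (normc_sum _ _)))//.
  rewrite mulr_sumr mulr_natl -[X in _ *+ X]card_ord -sumr_const.
  by apply: ler_sum => j _.
rewrite -weight_cube -/l 2!exprS expr1 -!mulrA.
have w0 : 0 <= w l n by exact: weight_ge0.
rewrite (le_trans (ler_wpM2l w0 (ler_wpM2l w0 sC)))//.
rewrite mulrC (mulrA _ _ C) [in leRHS]mulrA.
rewrite ler_wpM2r ?weight_ge0// ler_wpM2r// mulrC.
exact: MP.
Qed.

Local Notation D := (idfun \- cesaro_op halpha).

Lemma sub_cesaroE (x : Lam) n :
  D x n = x n - n.+1%:R^-1 * \sum_(j < n.+1) x j.
Proof. by rewrite -[LHS]/(x n - n.+1%:R^-1 * series x n.+1) /series/= big_mkord. Qed.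

Lemma sub_cesaro_coord0 (x : Lam) : D x 0%N = 0.
Proof. by rewrite sub_cesaroE big_ord1 invr1 mul1r subrr. Qed.

Lemma sum_cesaro_preimage (y : nat -> R[i]) n : y 0%N = 0 ->
  \sum_(i < n.+1) cesaro_preimage y i =
  n.+1%:R * \sum_(j < n.+1) y j / j%:R.
Proof.
move=> y0; elim: n => [|n IHn].
  by rewrite !big_ord1 /cesaro_preimage big_ord1 y0 mul0r addr0 mulr0.
rewrite big_ord_recr/= IHn /cesaro_preimage.
rewrite [\sum_(j < n.+2) _]big_ord_recr/=; set H := \sum_(j < n.+1) _.
have n0 : n.+1%:R != 0 :> R[i] by rewrite pnatr_eq0.
by rewrite -(natr1 n.+1) mulrDl mul1r mulrDr addrA (mulrC _ (_ / _)) divfK//.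
Qed.

(** The preimage is again in the hyperplane, which is what allows iteration. *)
Lemma sub_cesaro_surj (y : Lam) : y 0%N = 0 ->
  exists2 x : Lam, x 0%N = 0 & D x = y.
Proof.
move=> y0; exists (MkLambda0 (cesaro_preimage_subproof y)).
  by rewrite /= /cesaro_preimage big_ord1 y0 mul0r addr0.
apply/val_inj/funext => n.
rewrite -[LHS]/(D (MkLambda0 (cesaro_preimage_subproof y)) n) sub_cesaroE/=.
by rewrite sum_cesaro_preimage// mulKf ?pnatr_eq0// /cesaro_preimage addrK.
Qed.

Lemma range_iter_sub_cesaro m : (0 < m)%N ->
  range (iter m D) = [set y : Lam | y 0%N = 0].
Proof.
case: m => // m _; apply/seteqP; split=> [_ [x _ <-]|y /= y0].
  exact: sub_cesaro_coord0.
suff [x _ xy] : exists2 x : Lam, x 0%N = 0 & iter m.+1 D x = y.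
  by exists x.
elim: m.+1 => [|n [x x0 xy]]; first by exists y.
have [z z0 zx] := sub_cesaro_surj _ x0.
by exists z => //; rewrite iterSr zx.
Qed.

End CesaroRange.

Lemma closed_coord0 : closed [set y : Lam | y 0%N = 0].
Proof.
move=> y ycl; apply: contrapT => /eqP y0.
have e0 : 0 < w 0 0 * normc (y 0%N).
  rewrite mulr_gt0 ?weight_gt0// lt_neqAle normc_ge0 andbT eq_sym.
  by apply: contra_neq y0; exact: ComplexField.Normc.eq0_normc.
have [|z [/= z0 yz]] :=
  ycl (sn_ball (@Lambda0_norm R alpha) y (0%N, w 0 0 * normc (y 0%N))).
  by exists (0%N, w 0 0 * normc (y 0%N)).
have := yz 0%N (leqnn _); apply/negP; rewrite -leNgt /=.
apply: le_trans (Lambda0_norm_ub 0 _ 0%N).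
by rewrite -[X in _ <= _ * normc X]/(z 0%N - y 0%N) z0 normcB subr0.
Qed.

End CesaroOnPowerSeriesSpace.

Theorem proposition3p4 (R : realType) (alpha : nat -> R)
    (halpha : increasing_to_oo alpha)
    (hnuclear : nuclear_space (Lambda0 alpha : tvsType R[i]))
    (m : nat) (hm : (0 < m)%N) :
  closed_subspace (range (iter m (idfun \- cesaro_op halpha))).
Proof.
rewrite range_iter_sub_cesaro//; split=> //=; last exact: closed_coord0.
by move=> a u v u0 v0; rewrite -[LHS]/(a * u 0%N + v 0%N) u0 v0 mulr0 addr0.
Qed.
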